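(* Let $\beta\in[0,1)$ and let $V(X,\lambda)$ be the optimal value function of the single bandit problem $J(\lambda)$ with service charge $\lambda$ (defined in the context). For any $X\in\Omega$, $V(X,\lambda)$ is an increasing (i.e., non-decreasing), concave, and piecewise linear function of $\lambda\in[0,\infty)$. In addition, $$0\le \frac{\partial V(X,\lambda)}{\partial\lambda}\le\frac{1}{1-\beta}.$$
   Context: Let $2\le N<\infty$, $[N]=\{1,\dots,N\}$, $\Omega=\{x\in\mathbb{R}^N:\sum_{i=1}^N x_i=1,\ x_i\ge0 \text{ for all } i\}$, and let $H(x)=-\sum_{i=1}^N x_i\log_2x_i$ be the Shannon entropy (with $0\log_20=0$). Let $S(t)$ be an irreducible aperiodic Markov chain on $[N]$ with column-stochastic transition matrix $\mathbf{T}$, $\mathbf{T}_{kn}=P[S(t+1)=k\mid S(t)=n]$. $\mathbf{T}_k$ denotes the $k$-th column of $\mathbf{T}$. Let $\rho\in(0,1]$ (transmission success probability) and let $\beta\in[0,1)$ be a discount factor. Single bandit problem $J(\lambda)$, $\lambda\ge0$: a Markov decision process with actions $u\in\{0,1\}$ ($1$ active, $0$ passive) on belief states $X=(x_1,\dots,x_N)$, with belief state space extended to all of $\Omega$. The cost of the pair $(X,u)$ is $H(X)+\lambda u$. Under $u=1$ the next belief state is $\mathbf{T}_k$ with probability $\rho x_k$ ($k\in[N]$) and $\mathbf{T}X$ with probability $1-\rho$; under $u=0$ it is $\mathbf{T}X$ with probability 1. The aim is to minimize the expected total discounted cost $E[\sum_{t=1}^\infty\beta^{t-1}(H(X(t))+\lambda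 u(t))\mid X(1)=X]$. The optimal value $V(X,\lambda)$ satisfies, for $X\in\Omega$, the Bellman equation $$V(X,\lambda)=H(X)+\min\Big\{\lambda+\beta\rho\sum_{i=1}^Nx_iV(\mathbf{T}_i,\lambda)+\beta(1-\rho)V(\mathbf{T}X,\lambda),\ \beta V(\mathbf{T}X,\lambda)\Big\}.$$ The derivative bound is understood wherever the derivative exists (one-sided derivatives at the break points).
   Formalization: ''Piecewise linear'' here means continuous and affine between break points that are locally finite except possibly at one charge c, where they may accumulate; with (locally) finitely many pieces the claim fails, e.g. for a symmetric two-state chain (flip probability not 1/2) started at T_1. *)

(* Defs.v *)
From mathcomp Require Import all_boot all_order all_algebra.
From mathcomp Require Import all_classical all_reals all_analysis.

Set Implicit Arguments.
Unset Strict Implicit.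
Unset Printing Implicit Defensive.

Import Order.TTheory GRing.Theory Num.Theory.
Import numFieldNormedType.Exports.

Local Open Scope classical_set_scope.
Local Open Scope ring_scope.

(** MathComp-Analysis development: everything is stated over an arbitrary
    [R : realType]; beliefs are column vectors, actions are booleans
    ([true] = active). *)

Definition simplex (R : realType) (N : nat) : set 'cV[R]_N :=
  [set x | \sum_(i < N) x i 0 = 1 /\ forall i, 0 <= x i 0].

(** [ln 0 = 0] in the library, so the convention [0 * log2 0 = 0] holds. *)
Definition entropy (R : realType) (N : nat) (x : 'cV[R]_N) : R :=
  - \sum_(i < N) x i 0 * (ln (x i 0) / ln 2).

(** [T k n] is the probability of moving from [n] to [k]. *)
Definition column_stochastic (R : realType) (N : nat) (T : 'M[R]_N) : Prop :=
  forall n, simplex (col n T).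

Definition irreducible_chain (R : realType) (N : nat) (T : 'M[R]_N) : Prop :=
  forall i j, exists m : nat, 0 < (T ^+ m) i j.

(** The gcd of the possible return times to each state is 1. *)
Definition aperiodic_chain (R : realType) (N : nat) (T : 'M[R]_N) : Prop :=
  forall (i : 'I_N) (d : nat),
    (forall m : nat, (0 < m)%N -> 0 < (T ^+ m) i i -> (d %| m)%N) -> d = 1%N.

Definition history (R : realType) (N : nat) : Type := seq ('cV[R]_N * bool).

(** Randomized history-dependent policies: [pi h X] is the probability of
    being active in the current belief [X], where [h] lists the past
    belief-action pairs, oldest first. *)
Definition policy (R : realType) (N : nat) : Type :=
  history R N -> 'cV[R]_N -> R.

Definition is_policy (R : realType) (N : nat) (pi : policy R N) : Prop :=
  forall h X, 0 <= pi h X <= 1.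

Definition action_prob (R : realType) (N : nat) (pi : policy R N)
    (h : history R N) (X : 'cV[R]_N) (u : bool) : R :=
  if u then pi h X else 1 - pi h X.

(** Expectation of [g] at the next belief, given belief [X] and action [u]. *)
Definition next_expectation (R : realType) (N : nat) (T : 'M[R]_N) (rho : R)
    (X : 'cV[R]_N) (u : bool) (g : 'cV[R]_N -> R) : R :=
  if u then \sum_(k < N) rho * X k 0 * g (col k T) + (1 - rho) * g (T *m X)
  else g (T *m X).

Definition stage_cost (R : realType) (N : nat) (lambda : R)
    (X : 'cV[R]_N) (u : bool) : R :=
  entropy X + lambda * u%:R.

(** Expected cost incurred [t] steps from now, given the past [h] and the
    current belief [X]; all laws involved have finite support. *)
Fixpoint expected_cost (R : realType) (N : nat) (T : 'M[R]_N) (rho lambda : R)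
    (pi : policy R N) (t : nat) (h : history R N) (X : 'cV[R]_N) : R :=
  if t is t'.+1 then
    \sum_(u : bool) action_prob pi h X u *
      next_expectation T rho X u
        (expected_cost T rho lambda pi t' (rcons h (X, u)))
  else \sum_(u : bool) action_prob pi h X u * stage_cost lambda X u.

(** Time is shifted by one: [t = 0] is the initial step.  On the simplex the
    series converges, its terms being bounded by a geometric sequence. *)
Definition discounted_cost (R : realType) (N : nat) (T : 'M[R]_N)
    (rho beta lambda : R) (pi : policy R N) (X : 'cV[R]_N) : R :=
  limn (fun n : nat =>
    \sum_(0 <= t < n) beta ^+ t * expected_cost T rho lambda pi t [::] X).

Definition value (R : realType) (N : nat) (T : 'M[R]_N) (rho beta : R)
    (X : 'cV[R]_N) (lambda : R) : R :=
  inf [set discounted_cost T rho beta lambda pi X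
      | pi in [set pi : policy R N | is_policy pi]].

(** Continuous piecewise linear functions on [[0, +oo[]; [B] is the set of
    break points.  There may be infinitely many pieces, but the break points
    are locally finite except at one exceptional point [c], where they may
    accumulate.  This cannot be avoided for the value function: for the
    symmetric two-state chain with flip probability in ]0, 1[ other than 1/2,
    and [0 < beta], when started from a column of [T] its slopes are positive
    and tend to 0 as the charge increases to the least charge at which being
    active is no longer strictly profitable at the stationary belief. *)
Definition piecewise_linear (R : realType) (f : R -> R) : Prop :=
  {within `[0, +oo[, continuous f} /\
  exists (B : set R) (c : R),
    (forall a b, 0 <= a -> ~ `[a, b]%classic c ->
       finite_set (B `&` `[a, b])) /\
    (forall a b, 0 <= a -> a < b -> B `&` `]a, b[ = set0 ->
       exists p q, forall x, a <= x <= b -> f x = p * x + q).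

Definition concave_function (R : realType) (D : set R) (f : R -> R) : Prop :=
  convex_function (D : set (convex_lmodType R^o)) (fun x => - f x).

Definition is_right_derivative (R : realType) (f : R -> R) (x d : R) : Prop :=
  (fun h : R => h^-1 * (f (x + h) - f x)) @ 0^'+ --> d.

Definition is_left_derivative (R : realType) (f : R -> R) (x d : R) : Prop :=
  (fun h : R => h^-1 * (f (x + h) - f x)) @ 0^'- --> d.

(* Main.v *)
Require Import Defs.
From mathcomp Require Import all_boot all_order all_algebra finmap.
From mathcomp Require Import all_classical all_reals all_analysis.
From mathcomp Require Import ring lra zify.
Import Order.TTheory GRing.Theory Num.Theory.
Import numFieldNormedType.Exports.
Local Open Scope classical_set_scope.
Local Open Scope ring_scope.

(** Value iteration yields an optimal stationary policy for every charge, so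
    the value is a minimum of the costs of stationary policies; each of these
    is affine in the charge, with a slope (the expected discounted number of
    activations) in [0, 1 / (1 - beta)].  Monotonicity, concavity and the
    bounds on the derivatives follow.

    For piecewise linearity, let mu be the stationary distribution and
    A(lambda, X) the excess cost of the active action over the passive one.
    The belief converges to mu along passive steps, and A(lambda, mu) vanishes
    for at most one charge c: once passivity is optimal at mu, the value at mu
    is constant in the charge.  Near any lambda <> c, all but finitely many of
    the beliefs reachable from X share the preference of mu, hence the value is
    the minimum of finitely many affine functions. *)

(** * Convergence of the chain *)

(** The least positive gap [d] between two elements of [S] divides every element, since a nonzero
    remainder modulo [d] would be a smaller gap; so [d = 1]. Two consecutive elements [b] and
    [b + 1] then generate every integer from [b * b] on. *)
Lemma eventually_mem_addsemigroup (S : nat -> Prop) :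
  S 0%N -> (forall a b, S a -> S b -> S (a + b)%N) ->
  (forall d, (forall m, (0 < m)%N -> S m -> (d %| m)%N) -> d = 1%N) ->
  exists M, forall n, (M <= n)%N -> S n.
Proof.
move=> S0 SD Sgcd.
have SM a q : S a -> S (q * a)%N.
  by move=> Sa; elim: q => [//|q IH]; rewrite mulSn; exact: SD.
pose gap d := `[< (0 < d)%N /\ exists2 b, S b & S (b + d)%N >].
have ex_gap : exists d, gap d.
  have [[d [d0 Sd]]|noS] := pselect (exists d, (0 < d)%N /\ S d).
    by exists d; apply/asboolP; split => //; exists 0%N.
  (* Without a positive element in [S], the divisibility hypothesis holds vacuously for the divisor
     2. *)
  suff : 2%N = 1%N by [].
  by apply: Sgcd => m m0 Sm; case: noS; exists m.
case: (ex_minnP ex_gap) => d /asboolP[d0 [b Sb Sbd]] dmin.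
have d1 : d = 1%N.
  apply: Sgcd => m m0 Sm; rewrite /dvdn; apply: contraT; rewrite -lt0n => r0.
  have : gap (m %% d)%N.
    apply/asboolP; split => //; exists ((m %/ d) * (b + d))%N; first exact: SM.
    have -> : ((m %/ d) * (b + d) + m %% d = (m %/ d) * b + m)%N.
      by rewrite mulnDr -addnA -divn_eq.
    by apply: SD => //; apply: SM.
  by move/dmin; rewrite leqNgt ltn_mod d0.
rewrite d1 in Sbd.
exists (b * b)%N => n bn.
have [b0|b0] := posnP b; first by rewrite -[n]muln1; apply: SM; rewrite b0 in Sbd.
have qr : (n %% b <= n %/ b)%N.
  by rewrite (leq_trans (ltnW (ltn_pmod n b0)))// leq_divRL.
(* The truncated subtraction is exact by [qr]. *)
have -> : n = ((n %% b) * (b + 1) + (n %/ b - n %% b) * b)%N.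
  by rewrite [LHS](divn_eq n b) mulnBl mulnDr; nia.
by apply: SD; apply: SM.
Qed.

Section Markov.
Context {R : realType} {N : nat} (T : 'M[R]_N).
Hypothesis T_stoch : column_stochastic T.

Lemma transition_ge0 i j : 0 <= T i j.
Proof. by have [_ /(_ i)] := T_stoch j; rewrite mxE. Qed.

Lemma transition_sum1 j : \sum_i T i j = 1.
Proof. by have [<- _] := T_stoch j; apply: eq_bigr => i _; rewrite mxE. Qed.

Lemma sum_mulmx_transition (x : 'cV[R]_N) :
  \sum_i (T *m x) i 0 = \sum_i x i 0.
Proof.
under eq_bigr do rewrite mxE.
rewrite exchange_big /=; apply: eq_bigr => j _.
by rewrite -mulr_suml transition_sum1 mul1r.
Qed.

Lemma simplex_mulmx (x : 'cV[R]_N) : simplex x -> simplex (T *m x).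
Proof.
move=> [x1 x0]; split; first by rewrite sum_mulmx_transition.
by move=> i; rewrite mxE sumr_ge0// => j _; rewrite mulr_ge0// transition_ge0.
Qed.

Lemma iter_mulmx (x : 'cV[R]_N) n : iter n (mulmx T) x = T ^+ n *m x.
Proof. by elim: n => [|n IH]; rewrite ?mul1mx//= IH exprS mulmxA. Qed.

Lemma simplex_iter (x : 'cV[R]_N) n : simplex x -> simplex (iter n (mulmx T) x).
Proof. by move=> xs; elim: n => //= n; exact: simplex_mulmx. Qed.

Lemma col_stochastic_exp m : column_stochastic (T ^+ m).
Proof.
move=> n; elim: m => [|m IH].
  rewrite expr0; split.
    rewrite (bigD1 n)//= !mxE eqxx big1 ?addr0// => i /negPf ni.
    by rewrite !mxE ni.
  by move=> i; rewrite !mxE ler0n.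
by rewrite exprS colE -mulmxE -mulmxA -colE; exact: simplex_mulmx.
Qed.

Definition norm1 (z : 'cV[R]_N) := \sum_i `|z i 0|.

Lemma norm1_ge0 (z : 'cV[R]_N) : 0 <= norm1 z.
Proof. by apply: sumr_ge0. Qed.

Lemma norm1_ge (z : 'cV[R]_N) i : `|z i 0| <= norm1 z.
Proof. by rewrite /norm1 (bigD1 i)//= lerDl sumr_ge0. Qed.

(* A zero-sum vector is unchanged when [eps] is removed from all entries of
   the matrix; the columns of the remainder sum to [1 - N * eps]. *)
Lemma norm1_contraction (eps : R) (z : 'cV[R]_N) :
  (forall i j, eps <= T i j) -> \sum_i z i 0 = 0 ->
  norm1 (T *m z) <= (1 - N%:R * eps) * norm1 z.
Proof.
move=> epsT z0.
have Tz i : (T *m z) i 0 = \sum_j (T i j - eps) * z j 0.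
  under [RHS]eq_bigr do rewrite mulrBl.
  by rewrite sumrB -mulr_sumr z0 mulr0 subr0 mxE.
rewrite /norm1 mulr_sumr.
apply: (@le_trans _ _ (\sum_i \sum_j (T i j - eps) * `|z j 0|)).
  apply: ler_sum => i _; rewrite Tz (le_trans (ler_norm_sum _ _ _))//.
  by apply: ler_sum => j _; rewrite normrM ger0_norm// subr_ge0.
rewrite exchange_big /= ler_sum// => j _.
by rewrite -mulr_suml sumrB transition_sum1 sumr_const card_ord mulr_natl.
Qed.

End Markov.

Section Ergodic.
Context {R : realType} {N : nat} {T : 'M[R]_N}.
Hypothesis N_gt0 : (0 < N)%N.
Hypothesis T_stoch : column_stochastic T.
Hypothesis T_irr : irreducible_chain T.
Hypothesis T_aper : aperiodic_chain T.

Lemma exp_gt0D a b i j k :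
  0 < (T ^+ a) i j -> 0 < (T ^+ b) j k -> 0 < (T ^+ (a + b)) i k.
Proof.
move=> aij bjk; rewrite exprD mxE (bigD1 j)//= ltr_pwDl ?mulr_gt0//.
by apply: sumr_ge0 => l _; rewrite mulr_ge0// transition_ge0//;
  apply: col_stochastic_exp.
Qed.

(** All large return times to a state have positive probability, so a fixed path between two states
    can be padded with a return loop to a length common to all pairs. *)
Lemma primitive_chain : exists m, forall i j, 0 < (T ^+ m) i j.
Proof.
have return_large i : exists M, forall n, (M <= n)%N -> 0 < (T ^+ n) i i.
  apply: eventually_mem_addsemigroup; first by rewrite expr0 mxE eqxx ltr01.
    by move=> a b; exact: exp_gt0D.
  exact: T_aper.
have [M MP] := choice return_large.
have [r rP] := choice (fun ij : 'I_N * 'I_N => T_irr ij.1 ij.2).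
exists (\max_i M i + \max_ij r ij)%N => i j.
have rij : (r (i, j) <= \max_ij r ij)%N by exact: leq_bigmax.
have -> : (\max_i M i + \max_ij r ij =
           (\max_i M i + (\max_ij r ij - r (i, j))) + r (i, j))%N by lia.
apply: exp_gt0D (rP (i, j)); apply: MP.
by rewrite (leq_trans (leq_bigmax i))// leq_addr.
Qed.

Lemma primitive_chain_eps : exists m (eps : R),
  [/\ 0 < eps, N%:R * eps <= 1 & forall i j, eps <= (T ^+ m) i j].
Proof.
have [m mP] := primitive_chain.
pose i0 := Ordinal N_gt0.
case: (@arg_minP _ _ _ (i0, i0) predT (fun ij => (T ^+ m) ij.1 ij.2)) => //.
move=> ij _ ijmin.
exists m, ((T ^+ m) ij.1 ij.2).
have le_eps i j : (T ^+ m) ij.1 ij.2 <= (T ^+ m) i j by exact: (ijmin (i, j)).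
split => //; have Tm := col_stochastic_exp _ T_stoch m.
rewrite mulr_natl -[leRHS](transition_sum1 _ Tm i0) -[X in _ *+ X]card_ord.
rewrite -sumr_const.
exact: ler_sum.
Qed.

(** The norms decrease to some limit, and the contraction by [T ^+ m] bounds this limit by a factor
    below 1 times itself. *)
Lemma norm1_iter_cvg0 (z : 'cV[R]_N) : \sum_i z i 0 = 0 ->
  norm1 (iter n (mulmx T) z) @[n --> \oo] --> 0.
Proof.
move=> z0; have [m [eps [eps0 Neps epsT]]] := primitive_chain_eps.
pose a n := norm1 (iter n (mulmx T) z).
have sum0 n : \sum_i iter n (mulmx T) z i 0 = 0.
  by elim: n => //= n IH; rewrite sum_mulmx_transition.
have a_noninc : nonincreasing_seq a.
  apply/nonincreasing_seqP => n.
  (* With [eps = 0] the contraction only says that one step does not increase the norm. *)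
  apply: le_trans (norm1_contraction _ T_stoch 0 _ _ (sum0 n)) _.
    exact: transition_ge0.
  by rewrite mulr0 subr0 mul1r.
have a_cvg : cvgn a.
  apply: nonincreasing_is_cvgn => //.
  by exists 0 => _ [n _ <-]; exact: norm1_ge0.
have a_shift n : a (n + m)%N <= (1 - N%:R * eps) * a n.
  rewrite /a addnC iterD iter_mulmx.
  exact: norm1_contraction (col_stochastic_exp _ T_stoch m) _ _ epsT (sum0 n).
have lim_ge0 : 0 <= limn a.
  by apply: limr_ge => //; apply: nearW => n; exact: norm1_ge0.
have : limn a <= (1 - N%:R * eps) * limn a.
  have shift_cvg : a (n + m)%N @[n --> \oo] --> limn a by rewrite cvg_shiftn.
  apply: (ler_cvg_to shift_cvg (cvgM (cvg_cst (1 - N%:R * eps)) a_cvg)).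
  by apply: nearW => n; exact: a_shift.
have Neps0 : 0 < N%:R * eps by rewrite mulr_gt0// ltr0n.
rewrite mulrBl mul1r -subr_ge0 addrAC subrr add0r oppr_ge0 => le0.
suff <- : limn a = 0 by [].
by apply/eqP; rewrite eq_le lim_ge0 andbT -(pmulr_rle0 _ Neps0).
Qed.

(** The all-ones row is a left fixed vector, hence a right one [v] exists. Its entries cannot sum to
    0, for its constant orbit would then tend to 0; [mu] is [v] normalised. Convergence applies the
    zero-sum case to [x - mu], and positivity follows from [mu] being fixed by a power of [T] with
    positive entries. *)
Lemma stationary_distribution : exists mu : 'cV[R]_N,
  [/\ T *m mu = mu, simplex mu, forall i, 0 < mu i 0 &
    forall x, simplex x ->
      forall i, iter n (mulmx T) x i 0 @[n --> \oo] --> mu i 0].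
Proof.
have [v v_neq0 Tv] : exists2 v : 'cV[R]_N, v != 0 & T *m v = v.
  have : \det (T - 1%:M) == 0.
    apply/det0P; exists (const_mx 1).
      apply/eqP => /matrixP/(_ 0 (Ordinal N_gt0)); rewrite !mxE.
      by move/eqP; rewrite oner_eq0.
    apply/rowP => j; rewrite !mxE.
    under eq_bigr do rewrite !mxE mul1r.
    rewrite sumrB transition_sum1// (bigD1 j)//= eqxx big1 ?addr0 ?subrr//.
    by move=> i /negPf ->.
  rewrite -det_tr => /det0P[v v0 vT]; exists v^T; first by rewrite trmx_eq0.
  apply/eqP; rewrite -subr_eq0 -{2}[v^T]mul1mx -mulmxBl -trmx_eq0.
  by rewrite trmx_mul trmxK vT.
have Tnv n : iter n (mulmx T) v = v by elim: n => //= n ->.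
have sumv : \sum_i v i 0 != 0.
  apply: contra v_neq0 => /eqP /norm1_iter_cvg0.
  under eq_fun do rewrite Tnv.
  move=> /cvg_lim; rewrite lim_cst// => /(_ (@Rhausdorff _)) v0.
  apply/eqP/colP => i; rewrite mxE; apply/eqP; rewrite -normr_le0.
  by rewrite -v0 norm1_ge.
pose mu : 'cV[R]_N := (\sum_i v i 0)^-1 *: v.
have Tmu : T *m mu = mu by rewrite -scalemxAr Tv.
have mu1 : \sum_i mu i 0 = 1.
  by under eq_bigr do rewrite mxE; rewrite -mulr_sumr mulVf.
have Tnmu n : iter n (mulmx T) mu = mu by elim: n => //= n ->.
clearbody mu.
have mu_lim (x : 'cV[R]_N) : \sum_i x i 0 = 1 ->
    forall i, iter n (mulmx T) x i 0 @[n --> \oo] --> mu i 0.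
  move=> x1 i; have /norm1_iter_cvg0 xmu : \sum_i (x - mu) i 0 = 0.
    by under eq_bigr do rewrite !mxE; rewrite sumrB x1 mu1 subrr.
  apply/cvgrPdistC_le => e e0.
  have [k _ kP] := cvgr0_norm_le _ xmu _ e0.
  exists k => // n /kP /=; rewrite ger0_norm ?norm1_ge0//; apply: le_trans.
  rewrite (iter_mulmx _ (x - mu)) mulmxBr -!iter_mulmx Tnmu.
  by apply: le_trans (norm1_ge _ i); rewrite !mxE.
have mu_ge0 i : 0 <= mu i 0.
  have [x1 x0] := T_stoch (Ordinal N_gt0).
  apply: cvgr_to_ge (mu_lim _ x1 i) _; apply: nearW => n.
  by have [_] := simplex_iter T T_stoch _ n (T_stoch (Ordinal N_gt0)); apply.
exists mu; split => //; last by move=> x [x1 _]; exact: mu_lim.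
move=> i; have [m [eps [eps0 _ epsT]]] := primitive_chain_eps.
rewrite -(Tnmu m) iter_mulmx mxE (lt_le_trans eps0)//.
rewrite -[eps]mulr1 -mu1 mulr_sumr ler_sum// => j _.
by rewrite ler_wpM2r.
Qed.

End Ergodic.

(** * Lower envelopes of lines *)

Section LowerEnvelope.
Context {R : realType} {I : Type} (f : R -> R) (p q : I -> R) (K : R).
Hypothesis f_le : forall i (x : R), 0 <= x -> f x <= p i * x + q i.
Hypothesis f_eq : forall x : R, 0 <= x -> exists i, f x = p i * x + q i.
Hypothesis p_bound : forall i, 0 <= p i <= K.

Lemma envelope_nondecreasing : {in `[0, +oo[ &, {homo f : x y / x <= y}}.
Proof.
move=> x y; rewrite !in_itv/= !andbT => x0 y0 xy.
have [i ->] := f_eq y y0; apply: le_trans (f_le i x x0) _.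
by have /andP[p0 _] := p_bound i; rewrite lerD2r ler_wpM2l.
Qed.

Lemma envelope_increment x y : 0 <= x -> x <= y -> f y - f x <= K * (y - x).
Proof.
move=> x0 xy; have [i ->] := f_eq x x0.
have := f_le i y (le_trans x0 xy); have /andP[_ pK] := p_bound i.
have : p i * (y - x) <= K * (y - x) by rewrite ler_wpM2r// subr_ge0.
lra.
Qed.

Lemma envelope_lipschitz x y : 0 <= x -> 0 <= y -> `|f x - f y| <= K * `|x - y|.
Proof.
wlog xy : x y / x <= y => [wl x0 y0|x0 y0].
  by case/orP: (le_total x y) => ?; [|rewrite distrC (distrC x)]; apply: wl.
rewrite distrC (distrC x) !ger0_norm ?subr_ge0//; first exact: envelope_increment.
by apply: envelope_nondecreasing => //; rewrite in_itv/= ?x0 ?y0.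
Qed.

(** The line attaining [f] at the intermediate point lies above [f] at both ends. *)
Lemma envelope_concave : concave_function `[0, +oo[ f.
Proof.
move=> t x y; rewrite !inE/= !in_itv/= !andbT => x0 y0.
set t1 : R := t%:num; have t10 : 0 <= t1 by rewrite /t1.
have t20 : 0 <= 1 - t1 by rewrite subr_ge0 /t1.
(* The abstract convex combinations unfold definitionally to this form. *)
change (- f (t1 * x + (1 - t1) * y) <= t1 * (- f x) + (1 - t1) * (- f y)).
have z0 : 0 <= t1 * x + (1 - t1) * y by rewrite addr_ge0// mulr_ge0.
have [i ->] := f_eq _ z0.
have := ler_wpM2l t10 (f_le i x x0); have := ler_wpM2l t20 (f_le i y y0).
lra.
Qed.

Lemma envelope_continuous : {within `[0, +oo[, continuous f}.
Proof.
apply/subspace_continuousP => x; rewrite /= in_itv/= andbT => x0.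
apply/cvgrPdist_le => e e0; rewrite near_withinE.
have K0 : 0 <= K by have [i _] := f_eq x x0; case/andP: (p_bound i); apply: le_trans.
(* [K] may vanish, so the Lipschitz constant is enlarged before dividing by it. *)
have K1 : 0 < K + 1 by rewrite ltr_wpDl.
near=> y; rewrite /= in_itv/= andbT => y0.
apply: le_trans (envelope_lipschitz x y x0 y0) _.
apply: (@le_trans _ _ ((K + 1) * `|x - y|)); first by rewrite ler_wpM2r// lerDl.
rewrite mulrC -ler_pdivlMr//.
near: y; apply: cvgr_dist_le; first exact: cvg_id.
by rewrite divr_gt0.
Unshelve. all: by end_near. Qed.

Let slope x h := h^-1 * (f (x + h) - f x).

Lemma slope_bound x h : 0 <= x -> 0 <= x + h -> h != 0 -> 0 <= slope x h <= K.
Proof.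
move=> x0 xh0 h0; rewrite /slope.
have mono := envelope_nondecreasing.
case: (ltgtP 0 h) h0 => [h_gt0 _|h_lt0 _|]; last by [].
- rewrite mulrC divr_ge0 ?(ltW h_gt0)//=; last first.
    by rewrite subr_ge0; apply: mono; rewrite ?in_itv/= ?andbT// lerDl ltW.
  have := envelope_increment x (x + h) x0; rewrite lerDl (ltW h_gt0) => /(_ isT).
  by rewrite ler_pdivrMr// [x + h]addrC addrK.
- have -> : h^-1 * (f (x + h) - f x) = (f x - f (x + h)) / - h.
    by rewrite invrN mulrN -mulNr opprB mulrC.
  have Nh0 : 0 < - h by rewrite oppr_gt0.
  rewrite divr_ge0 ?(ltW Nh0)//=; last first.
    by rewrite subr_ge0; apply: mono; rewrite ?in_itv/= ?andbT// gerDl ltW.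
  have := envelope_increment (x + h) x xh0; rewrite gerDl (ltW h_lt0) => /(_ isT).
  by rewrite ler_pdivrMr// opprD addrA subrr add0r.
Qed.

(** The condition [0 < h * k] says that both increments have the same sign, and multiplying by it
    clears the denominators. The line attaining [f] at the middle one of the three points, [x + h]
    or [x + k] according to the sign, is then compared with [f] at the other two. *)
Lemma slope_nonincreasing x h k : 0 <= x -> 0 <= x + h -> h <= k -> 0 < h * k ->
  slope x k <= slope x h.
Proof.
move=> x0 xh0 hk hk0; rewrite /slope.
have xk0 : 0 <= x + k by rewrite (le_trans xh0)// lerD2l.
have h0 : h != 0 by apply: contraTneq hk0 => ->; rewrite mul0r ltxx.
have k0 : k != 0 by apply: contraTneq hk0 => ->; rewrite mulr0 ltxx.
rewrite -(ler_pM2l hk0) [h * k]mulrC -[leRHS]mulrA mulVKf// [k * h]mulrC.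
rewrite -mulrA mulVKf//.
case: (ltgtP 0 h) h0 => [h_gt0 _|h_lt0 _|]; last by [].
- have [i ei] := f_eq _ xh0; rewrite ei.
  have := ler_wpM2l (ltW h_gt0) (f_le i _ xk0).
  have kh : 0 <= k - h by rewrite subr_ge0.
  have := ler_wpM2l kh (f_le i _ x0).
  lra.
- have [i ei] := f_eq _ xk0; rewrite ei.
  have k_lt0 : k < 0 by rewrite -(nmulr_rgt0 _ h_lt0).
  have Nk0 : 0 <= - k by rewrite oppr_ge0 ltW.
  have := ler_wpM2l Nk0 (f_le i _ xh0).
  have kh : 0 <= k - h by rewrite subr_ge0.
  have := ler_wpM2l kh (f_le i _ x0).
  lra.
Qed.

Lemma envelope_right_derivative x : 0 <= x ->
  exists2 d, is_right_derivative f x d & 0 <= d <= K.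
Proof.
move=> x0; have sb h : 0 < h -> 0 <= slope x h <= K.
  by move=> h0; apply: slope_bound; rewrite ?addr_ge0 ?gt_eqF// ltW.
have sl_cvg : cvg (slope x @ 0^'+).
  apply: nonincreasing_at_right_is_cvgr; near=> b.
    move=> h k; rewrite !in_itv/= => /andP[h0 _] /andP[k0 _] hk.
    by apply: slope_nonincreasing; rewrite ?mulr_gt0 ?addr_ge0// ltW.
  exists K => y [h /=]; rewrite in_itv/= => /andP[h0 _] <-.
  by have /andP[] := sb h h0.
exists (lim (slope x @ 0^'+)); first exact: sl_cvg.
apply/andP; split; [apply: limr_ge => //|apply: limr_le => //]; near=> h.
  by have /andP[] : 0 <= slope x h <= K by apply: sb; near: h; exact: nbhs_right_gt.
by have /andP[] : 0 <= slope x h <= K by apply: sb; near: h; exact: nbhs_right_gt.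
Unshelve. all: by end_near. Qed.

Lemma envelope_left_derivative x : 0 < x ->
  exists2 d, is_left_derivative f x d & 0 <= d <= K.
Proof.
move=> x0; have Nx0 : - x < 0 by rewrite oppr_lt0.
have sb h : h \in `]-x, 0[ -> 0 <= slope x h <= K.
  rewrite in_itv/= => /andP[xh h0].
  by apply: slope_bound; rewrite ?lt_eqF//; lra.
have sl_cvg : cvg (slope x @ 0^'-).
  rewrite -[slope x]opprK; apply: is_cvgN.
  apply: nondecreasing_at_left_is_cvgr; near=> b.
    have xb : - x <= b by near: b; exact: nbhs_left_ge.
    move=> h k; rewrite !in_itv/= => /andP[bh h0] /andP[bk k0] hk.
    by rewrite lerN2; apply: slope_nonincreasing; rewrite ?nmulr_rgt0//; lra.
  have xb : - x <= b by near: b; exact: nbhs_left_ge.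
  exists 0 => y [h /=]; rewrite in_itv/= => /andP[bh h0] <-.
  rewrite oppr_le0; have /andP[//] : 0 <= slope x h <= K.
  by apply: sb; rewrite in_itv/= h0 (le_lt_trans xb).
exists (lim (slope x @ 0^'-)); first exact: sl_cvg.
have sb_near : \forall h \near 0^'-, 0 <= slope x h <= K.
  near=> h; apply: sb; rewrite in_itv/=; apply/andP; split.
    by near: h; exact: nbhs_left_gt.
  by near: h; exact: nbhs_left_lt.
apply/andP; split; [apply: limr_ge => //|apply: limr_le => //];
  by apply: filterS sb_near => h /andP[].
Unshelve. all: by end_near. Qed.

Lemma envelope_derive1 x : 0 < x -> derivable f x 1 -> 0 <= derive1 f x <= K.
Proof.
move=> x0 dfx; have fE : (fun h => h^-1 *: (f (h + x) - f x)) =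
    (fun h => h^-1 *: ((f \o shift x) (h *: 1) - f x)).
  by apply/funext => h /=; rewrite [h%:A]mulr1.
have sb : \forall h \near 0^', 0 <= h^-1 *: (f (h + x) - f x) <= K.
  near=> h; rewrite [h + x]addrC; apply: slope_bound; [exact: ltW| |].
    have : `|h| <= x by near: h; apply: dnbhs0_le.
    by rewrite ler_norml => /andP[? _]; lra.
  by near: h; exact: nbhs_dnbhs_neq.
move: dfx; rewrite /derivable -fE /derive1 => dfx.
apply/andP; split; [apply: limr_ge => //|apply: limr_le => //];
  by apply: filterS sb => h /andP[].
Unshelve. all: by end_near. Qed.

End LowerEnvelope.

(** * From local minima of finitely many lines to piecewise linearity *)

Section PiecewiseAffine.
Context {R : realType}.
Implicit Types (f : R -> R) (s : seq (R * R)) (x a b c : R).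

Definition locally_affine f (x : R) :=
  exists p q, \forall y \near x, f y = p * y + q.

(** A line is coded as the pair of its slope and its intercept. *)
Definition min_of_lines f s (x : R) :=
  {in s, forall z, f x <= z.1 * x + z.2} /\
  exists2 z, z \in s & f x = z.1 * x + z.2.

Lemma near_all {T : topologicalType} (x : T) (J : eqType) (s : seq J)
    (P : J -> T -> Prop) :
  (forall z, z \in s -> \forall y \near x, P z y) ->
  \forall y \near x, forall z, z \in s -> P z y.
Proof.
elim: s => [|z s IH] sP; first exact: nearW.
have zP := sP z (mem_head _ _).
have {}IH : \forall y \near x, forall z, z \in s -> P z y.
  by apply: IH => w ws; apply: sP; rewrite inE ws orbT.
near=> y => w; rewrite inE => /predU1P[->|]; first by near: y.
by move: w; near: y.
Unshelve. all: by end_near. Qed.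

Lemma line_continuous (p q : R) : continuous (fun y : R => p * y + q).
Proof.
move=> x; apply: cvgD; last exact: cvg_cst.
by apply: cvgM; [exact: cvg_cst|exact: cvg_id].
Qed.

(* Pairs of parallel lines contribute the harmless junk value [x / 0 = 0]. *)
Definition crossings s :=
  [seq (z.2 - w.2) / (w.1 - z.1) | z <- s, w <- s].

(** Let [z] attain the minimum at [x]. A different line through the same point would have another
    slope and make [x] a crossing; so all other lines are strictly above at [x], and by continuity
    on a common neighbourhood. *)
Lemma min_of_lines_locally_affine f s x :
  (\forall y \near x, min_of_lines f s y) -> x \notin crossings s ->
  locally_affine f x.
Proof.
move=> fs xs; have [fxle [z zs fxz]] := nbhs_singleton fs.
exists z.1, z.2.
have above w : w \in s -> \forall y \near x,
    w = z \/ z.1 * y + z.2 < w.1 * y + w.2.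
  move=> ws; have [->|wz] := eqVneq w z; first by near=> y; left.
  suff lt_x : z.1 * x + z.2 < w.1 * x + w.2.
    suff : \forall y \near x, z.1 * y + z.2 < w.1 * y + w.2.
      by apply: filterS => y; right.
    have dc : (w.1 * y + w.2) - (z.1 * y + z.2) @[y --> x] -->
        (w.1 * x + w.2) - (z.1 * x + z.2).
      by apply: cvgB; exact: line_continuous.
    have : \forall y \near x, 0 < (w.1 * y + w.2) - (z.1 * y + z.2).
      by apply: (cvgr_gt _ dc); rewrite subr_gt0.
    by apply: filterS => y; rewrite subr_gt0.
  rewrite -fxz lt_neqAle fxle// andbT; apply: contra xs => /eqP eq_x.
  have pp : w.1 - z.1 != 0.
    apply: contraNneq wz => /eqP; rewrite subr_eq0 => /eqP pp.
    rewrite (surjective_pairing w) (surjective_pairing z) pp; apply/eqP.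
    by congr pair; move: eq_x; rewrite fxz pp => /addrI.
  apply/allpairsP; exists (z, w); split => //=.
  by apply: (canRL (mulfK pp)); move: eq_x; rewrite fxz; lra.
have {}above := near_all x _ s _ above.
near=> y.
have [fyle [w ws fyw]] : min_of_lines f s y by near: y.
have := fyle z zs; rewrite fyw.
have [->//|] : w = z \/ z.1 * y + z.2 < w.1 * y + w.2.
  by move: w ws {fyw}; near: y.
by move=> /lt_le_trans/[apply]; rewrite ltxx.
Unshelve. all: by end_near. Qed.

Lemma near_lines_eq (p q p' q' : R) x :
  (\forall y \near x, p * y + q = p' * y + q') -> p = p' /\ q = q'.
Proof.
move=> eq_near; have eq_x := nbhs_singleton eq_near.
have [y] : exists y, x < y /\ p * y + q = p' * y + q'.
  near x^'+ => y; exists y; split => //.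
  near: y; exact: cvg_within.
move=> [xy eq_y]; have pp : (p - p') * (y - x) = 0 by lra.
have {}pp : p = p'.
  move/eqP: pp; rewrite mulf_eq0 => /orP[|]; rewrite subr_eq0 => /eqP //.
  by move=> yx; rewrite yx ltxx in xy.
by split=> //; move: eq_x; rewrite pp => /addrI.
Unshelve. all: by end_near. Qed.

(** Connectedness: the set [G] of points near which [f] follows the line found at the midpoint is
    open and closed in the open interval. Continuity extends the equality to the endpoints. *)
Lemma locally_affine_itv f a b : a < b -> {within `[a, b], continuous f} ->
  (forall x, a < x < b -> locally_affine f x) ->
  exists p q, forall x, a <= x <= b -> f x = p * x + q.
Proof.
move=> ab fc fla; have [_ fa fb] := (continuous_within_itvP f ab).1 fc.
have mab : a < (a + b) / 2 < b by rewrite midf_lt//= midf_lt.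
have [p [q fm]] := fla _ mab; exists p, q.
pose G : set R := [set x : R | \forall y \near x, f y = p * y + q].
have GE : `]a, b[%classic `&` G = `]a, b[%classic.
  have /connected_intervalP : is_interval `]a, b[%classic.
    exact: interval_is_interval.
  apply.
  - by exists ((a + b) / 2); split => //=; rewrite in_itv.
  - by exists G => //; exact: open_interior.
  - exists (closure G); first exact: closed_closure.
    apply/seteqP; split=> x [xab Gx]; split => //; first exact: subset_closure.
    have [p' [q' fx]] : locally_affine f x by apply: fla; rewrite /= in_itv/= in xab.
    (* Near [y], a point of [G] close to [x], both the local line at [x] and the line of [G]
       represent [f], so they coincide. *)
    have [y [Gy fy]] := Gx _ (nbhs_interior fx).
    have [pE qE] : p' = p /\ q' = q; last by rewrite /G /= -pE -qE.
    apply: (near_lines_eq _ _ _ _ y); near=> z.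
    have <- : f z = p' * z + q' by near: z.
    by near: z.
have f_in x : a < x < b -> f x = p * x + q.
  move=> xab; have : `]a, b[%classic x by rewrite /= in_itv.
  by rewrite -GE => -[_ /nbhs_singleton].
move=> x; rewrite le_eqVlt => /andP[/predU1P[<-{x} _|ax]].
  have la := cvg_at_right_filter (line_continuous p q a).
  suff fla' : f y @[y --> a^'+] --> p * a + q by exact: (cvg_unique _ fa fla').
  apply: cvg_trans la; apply: near_eq_cvg.
  near=> y; rewrite f_in//; apply/andP; split; near: y.
    exact: nbhs_right_gt.
  exact: nbhs_right_lt.
rewrite le_eqVlt => /predU1P[->|xb]; last by rewrite f_in ?ax.
have lb := cvg_at_left_filter (line_continuous p q b).
suff flb : f y @[y --> b^'-] --> p * b + q by exact: (cvg_unique _ fb flb).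
apply: cvg_trans lb; apply: near_eq_cvg.
near=> y; rewrite f_in//; apply/andP; split; near: y.
  exact: nbhs_left_gt.
exact: nbhs_left_lt.
Unshelve. all: by end_near. Qed.

Lemma locally_finite_itv (B : set R) a b :
  (forall x, a <= x <= b -> exists2 U, nbhs x U & finite_set (B `&` U)) ->
  finite_set (B `&` `[a, b]).
Proof.
move=> Bfin.
have exU x : exists U, a <= x <= b -> nbhs x U /\ finite_set (B `&` U).
  have [/Bfin[U xU fU]|nx] := boolP (a <= x <= b); first by exists U.
  (* A dummy value outside the segment, to make the choice function total. *)
  by exists setT.
have [U UP] := choice exU.
have := @segment_compact R a b; rewrite compact_cover.
move=> /(_ R `[a, b]%classic (fun x => (U x)°)).
case=> [x _||D Dab cov].
- exact: open_interior.
- move=> x xab; exists x => //; apply: nbhs_singleton; apply: nbhs_interior.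
  by have [] := UP x; move: xab; rewrite /= in_itv.
have sub : B `&` `[a, b] `<=` \bigcup_(i in [set` D]) (B `&` U i).
  move=> x [Bx /cov [i iD Uix]]; exists i => //; split => //.
  exact: interior_subset Uix.
apply: sub_finite_set sub _; apply: bigcup_finite => // i iD.
have : i \in `[a, b]%classic by exact: Dab.
move/set_mem; rewrite /= in_itv/= => iab.
by have [] := UP i iab.
Qed.

Lemma piecewise_linear_locally_min f c :
  {within `[0, +oo[, continuous f} ->
  (forall x, 0 <= x -> x != c -> exists (eps : R) s, 0 < eps /\
     forall y, 0 <= y -> `|y - x| < eps -> min_of_lines f s y) ->
  piecewise_linear f.
Proof.
move=> fc fmin; split => //.
(* Local affineness is two-sided while [f] is controlled only on nonnegative reals, so 0 is not
   counted as a break point. *)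
exists [set x | 0 < x /\ ~ locally_affine f x], c; split.
  move=> a b a0 abc; apply: locally_finite_itv => x /andP[ax xb].
  have xc : x != c.
    apply: contra_not_neq abc => <-; by rewrite /= in_itv/= ax.
  have [eps [s [eps0 fs]]] := fmin x (le_trans a0 ax) xc.
  exists (ball x eps); first exact: nbhsx_ballx.
  apply: (@sub_finite_set _ _ [set` crossings s]); last exact: finite_seq.
  move=> y /= [[y0 yna] xy]; apply: contrapT => /negP ys; apply: yna.
  apply: min_of_lines_locally_affine ys.
  have bally : nbhs y (ball x eps) by apply: open_nbhs_nbhs; split => //; exact: ball_open.
  near=> t; apply: fs.
    by apply: ltW; near: t; exact: lt_nbhsr.
  by rewrite distrC; near: t.
move=> a b a0 ab Bab; apply: locally_affine_itv => //.
  apply: continuous_subspaceW fc => x /=; rewrite !in_itv/= andbT => /andP[ax _].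
  exact: le_trans ax.
move=> x xab; apply: contrapT => xna.
have : set0 x by rewrite -Bab; split => //=; split => //; case/andP: xab; lra.
by [].
Unshelve. all: by end_near. Qed.

End PiecewiseAffine.

(** * The bandit problem *)

(** Each term is bounded through [- x * ln x <= 1], obtained from [ln t <= t - 1] at [t = 1 / x].
    The bound is crude, but any uniform bound will do. *)
Lemma entropy_bound (R : realType) (N : nat) (x : 'cV[R]_N) :
  simplex x -> 0 <= entropy x <= N%:R / ln 2.
Proof.
move=> [x1 x0]; have ln2 : 0 < ln 2 :> R by rewrite ln_gt0// ltr1n.
have xle1 i : x i 0 <= 1 by rewrite -x1 (bigD1 i)//= lerDl sumr_ge0.
have term i : 0 <= - (x i 0 * (ln (x i 0) / ln 2)) <= (ln 2)^-1.
  rewrite mulrA -mulNr; have := x0 i; rewrite le_eqVlt => /predU1P[<-|xi0].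
    by rewrite mul0r oppr0 mul0r lexx invr_ge0 ltW.
  have xlnx : - (x i 0 * ln (x i 0)) <= 1.
    have xiV : 0 < (x i 0)^-1 by rewrite invr_gt0.
    have : -1 < (x i 0)^-1 - 1 by rewrite ltrBrDl subrr.
    move/le_ln1Dx; rewrite [1 + _]addrC subrK lnV// -(ler_pM2l xi0) mulrBr.
    by rewrite mulfV ?gt_eqF//; lra.
  rewrite ler_pdivrMr// mulVf ?gt_eqF// xlnx andbT divr_ge0 ?(ltW ln2)//.
  by rewrite oppr_ge0 mulr_ge0_le0// ln_le0.
rewrite /entropy -sumrN; apply/andP; split.
  by apply: sumr_ge0 => i _; have /andP[] := term i.
have <- : \sum_(i < N) (ln 2)^-1 = N%:R / ln 2 :> R.
  by rewrite sumr_const card_ord mulr_natl.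
by apply: ler_sum => i _; have /andP[] := term i.
Qed.

Lemma dist_min_le (R : realDomainType) (a b a' b' C : R) :
  `|a - a'| <= C -> `|b - b'| <= C ->
  `|Num.min a b - Num.min a' b'| <= C.
Proof.
rewrite !ler_norml /Order.min => /andP[? ?] /andP[? ?].
by case: ltP => ?; case: ltP => ?; lra.
Qed.

Lemma cvg_min {R : realType} {I : Type} {F : set_system I} {FF : Filter F}
    (f g : I -> R) (a b : R) : f @ F --> a -> g @ F --> b ->
  Num.min (f x) (g x) @[x --> F] --> Num.min a b.
Proof.
move=> /cvgrPdist_le fa /cvgrPdist_le gb; apply/cvgrPdist_le => e e0.
by near=> x; apply: dist_min_le; near: x; [exact: fa|exact: gb].
Unshelve. all: by end_near. Qed.

(** * The one-step expectation operator *)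

Section NextExpectation.
Context {R : realType} {N : nat} {T : 'M[R]_N} {rho : R}.
Hypothesis T_stoch : column_stochastic T.
Hypothesis rho01 : 0 < rho <= 1.
Local Notation belief := 'cV[R]_N.
Local Notation next := (next_expectation T rho).
Implicit Types (X Y : belief) (u : bool) (g : belief -> R) (P : set belief).

(** Sets of beliefs that the process cannot leave. Comparisons are made relative to such a set,
    either the whole simplex or the beliefs reachable from one starting point. *)
Definition reach_closed P :=
  [/\ P `<=` @simplex R N, forall X, P X -> P (T *m X) & forall k, P (col k T)].

Lemma simplex_closed : reach_closed (@simplex R N).
Proof. by split => // X; exact: simplex_mulmx. Qed.

Lemma next_linear X u a g g' :
  next X u (fun Y => a * g Y + g' Y) = a * next X u g + next X u g'.
Proof.
case: u => //=; rewrite mulrDr mulrDr addrACA; congr (_ + _); last by rewrite mulrCA.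
rewrite mulr_sumr -big_split /=; apply: eq_bigr => k _.
by rewrite mulrDr mulrCA.
Qed.

Lemma next0 X u : next X u (fun=> 0) = 0.
Proof. by case: u => //=; rewrite mulr0 addr0 big1// => k _; rewrite mulr0. Qed.

Lemma next_cst X u (a : R) : simplex X -> next X u (fun=> a) = a.
Proof.
move=> [X1 _]; case: u => //=.
by rewrite -mulr_suml -mulr_sumr X1 mulr1 -mulrDl addrC subrK mul1r.
Qed.

Lemma next_le P X u g g' : reach_closed P -> P X ->
  (forall Y, P Y -> g Y <= g' Y) -> next X u g <= next X u g'.
Proof.
have /andP[rho0 rho1] := rho01.
move=> [Ps PT Pc] PX gg'; case: u => /=; last exact/gg'/PT.
rewrite lerD//; last by rewrite ler_wpM2l ?subr_ge0//; exact/gg'/PT.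
have [_ X0] := Ps _ PX.
by apply: ler_sum => k _; rewrite ler_wpM2l ?gg'// mulr_ge0// ltW.
Qed.

(** A monotone linear operator fixing constants is nonexpansive in the sup norm. *)
Lemma next_dist P X u g g' C : reach_closed P -> P X ->
  (forall Y, P Y -> `|g Y - g' Y| <= C) -> `|next X u g - next X u g'| <= C.
Proof.
move=> Pcl PX gC; have Xs : simplex X by have [Ps _ _] := Pcl; exact: Ps.
have shift h : next X u (fun Y => 1 * h Y + C) = next X u h + C.
  by rewrite next_linear mul1r next_cst.
rewrite ler_distl lerBlDr -!shift; apply/andP; split;
  apply: (next_le P) => // Y /gC; rewrite ler_distl mul1r.
  by rewrite lerBlDr => /andP[].
by case/andP.
Qed.

Lemma next_cvg P X u (g : nat -> belief -> R) g' : reach_closed P -> P X ->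
  (forall Y, P Y -> g n Y @[n --> \oo] --> g' Y) ->
  next X u (g n) @[n --> \oo] --> next X u g'.
Proof.
move=> [_ PT Pc] PX gg'; case: u => /=; last exact/gg'/PT.
apply: cvgD; last by apply: cvgM; [exact: cvg_cst|exact/gg'/PT].
apply: cvg_big => [|k _]; first exact: add_continuous.
by apply: cvgM; [exact: cvg_cst|exact: gg'].
Qed.

End NextExpectation.

Arguments reach_closed {R N} T P.

(** * Costs of policies over finite and infinite horizons *)

Section Evaluation.
Context {R : realType} {N : nat} {T : 'M[R]_N} {rho beta : R}.
Hypothesis T_stoch : column_stochastic T.
Hypothesis rho01 : 0 < rho <= 1.
Hypothesis beta01 : 0 <= beta < 1.
Local Notation belief := 'cV[R]_N.
Local Notation next := (next_expectation T rho).
Implicit Types (lam : R) (X Y : belief) (d : belief -> bool) (g : belief -> R).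

Let beta0 : 0 <= beta. Proof. by case/andP: beta01. Qed.
Let beta1 : 0 < 1 - beta. Proof. by rewrite subr_gt0; case/andP: beta01. Qed.

Definition horizon_cost lam (pi : policy R N) n (h : history R N) X : R :=
  \sum_(0 <= t < n) beta ^+ t * expected_cost T rho lam pi t h X.

Lemma horizon_cost_recr lam pi n h : horizon_cost lam pi n.+1 h =
  fun X => beta ^+ n * expected_cost T rho lam pi n h X + horizon_cost lam pi n h X.
Proof. by apply/funext => X; rewrite /horizon_cost big_nat_recr//= addrC. Qed.

(** Dynamic programming splits off the first step, whereas the sum grows at its last term; the
    induction on [n] reconciles the two by linearity of the expectation. *)
Lemma horizon_costS lam pi n h X : horizon_cost lam pi n.+1 h X =
  \sum_(u : bool) action_prob pi h X u *
    (stage_cost lam X u +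
     beta * next X u (horizon_cost lam pi n (rcons h (X, u)))).
Proof.
elim: n => [|n IH] in h X *.
  rewrite {1}/horizon_cost big_nat1 expr0 mul1r; apply: eq_bigr => u _.
  rewrite (_ : horizon_cost _ _ 0 _ = fun=> 0) ?next0 ?mulr0 ?addr0//.
  by apply/funext => Y; rewrite /horizon_cost big_geq.
rewrite [LHS](congr1 (@^~ X) (horizon_cost_recr _ _ _ _)) IH mulr_sumr -big_split /=.
apply: eq_bigr => u _; rewrite horizon_cost_recr next_linear exprS.
ring.
Qed.

Let C : R := N%:R / ln 2.

Let C_ge0 : 0 <= C.
Proof. by rewrite divr_ge0// ltW// ln_gt0// ltr1n. Qed.

Lemma convex_comb_norm (p a b c : R) : 0 <= p <= 1 -> `|a| <= c -> `|b| <= c ->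
  `|p * a + (1 - p) * b| <= c.
Proof.
move=> /andP[p0 p1] ac bc; have q0 : 0 <= 1 - p by rewrite subr_ge0.
rewrite (le_trans (ler_normD _ _))// !normrM (ger0_norm p0) (ger0_norm q0).
have := ler_wpM2l p0 ac; have := ler_wpM2l q0 bc; lra.
Qed.

Lemma next_norm X u g c : simplex X ->
  (forall Y, simplex Y -> `|g Y| <= c) -> `|next X u g| <= c.
Proof.
move=> Xs gc; rewrite -[next X u g]subr0 -(@next0 _ _ T rho X u).
apply: (next_dist rho01 (@simplex R N)) => // [|Y Ys]; first exact: simplex_closed.
by rewrite subr0; exact: gc.
Qed.

Lemma stage_cost_norm lam X u : simplex X -> `|stage_cost lam X u| <= C + `|lam|.
Proof.
move=> /entropy_bound/andP[H0 HC]; rewrite (le_trans (ler_normD _ _))//.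
rewrite ger0_norm// lerD// normrM; case: u; rewrite /= ?normr1 ?mulr1//.
by rewrite normr0 mulr0.
Qed.

Lemma expected_cost_norm lam pi t h X : is_policy pi -> simplex X ->
  `|expected_cost T rho lam pi t h X| <= C + `|lam|.
Proof.
move=> pi01; elim: t => [|t IH] in h X * => Xs /=.
  by rewrite big_bool; apply: convex_comb_norm (pi01 h X) _ _; exact: stage_cost_norm.
rewrite big_bool; apply: convex_comb_norm (pi01 h X) _ _;
    by apply: (next_norm X _ _ _ Xs) => Y; exact: IH.
Qed.

Lemma horizon_cost_norm lam pi n h X : is_policy pi -> simplex X ->
  `|horizon_cost lam pi n h X| <= (C + `|lam|) / (1 - beta).
Proof.
move=> pi01; set c := C + `|lam|.
have c0 : 0 <= c / (1 - beta) by rewrite divr_ge0 ?(ltW beta1)// addr_ge0.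
(* The bound is the fixed point of the map sending [a] to [c + beta * a], hence stable under one
   more step. *)
have cE : c / (1 - beta) = c + beta * (c / (1 - beta)).
  by field; rewrite gt_eqF.
elim: n => [|n IH] in h X * => Xs; first by rewrite /horizon_cost big_geq// normr0.
have step u : `|stage_cost lam X u +
    beta * next X u (horizon_cost lam pi n (rcons h (X, u)))| <= c / (1 - beta).
  rewrite cE (le_trans (ler_normD _ _))// lerD ?stage_cost_norm//.
  rewrite normrM ger0_norm// ler_wpM2l//.
  by apply: (next_norm X _ _ _ Xs) => Y; exact: IH.
by rewrite horizon_costS big_bool; exact: convex_comb_norm (pi01 h X) _ _.
Qed.

Lemma discounted_cost_cvg lam pi X : is_policy pi -> simplex X ->
  horizon_cost lam pi n [::] X @[n --> \oo] -->
  discounted_cost T rho beta lam pi X.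
Proof.
move=> pi01 Xs.
suff : cvgn (series (fun t => beta ^+ t * expected_cost T rho lam pi t [::] X)) by [].
apply: normed_cvg.
apply: (@series_le_cvg _ _ (geometric (C + `|lam|) beta)) => [n|n|n|] /=.
- exact: normr_ge0.
- by rewrite mulr_ge0 ?exprn_ge0// addr_ge0.
- rewrite normrM ger0_norm ?exprn_ge0// mulrC ler_wpM2r ?exprn_ge0//.
  exact: expected_cost_norm.
- by apply: is_cvg_geometric_series; rewrite ger0_norm//; case/andP: beta01.
Qed.

(** * Stationary policies and their affine costs *)

Definition stationary d : policy R N := fun _ X => (d X)%:R.

Lemma stationary_policy d : is_policy (stationary d).
Proof. by move=> h X; rewrite /stationary; case: (d X); rewrite ?ler01 lexx. Qed.

Lemma horizon_stationaryS lam d n h X :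
  horizon_cost lam (stationary d) n.+1 h X =
  stage_cost lam X (d X) +
  beta * next X (d X) (horizon_cost lam (stationary d) n [::]).
Proof.
have indep m h' : horizon_cost lam (stationary d) m h' =
                  horizon_cost lam (stationary d) m [::].
  elim: m h' => [|m IH] h'; apply/funext => Y; first by rewrite /horizon_cost !big_geq.
  rewrite !horizon_costS; apply: eq_bigr => u _.
  by rewrite IH [in RHS]IH.
rewrite horizon_costS big_bool !indep /action_prob /stationary.
by case: (d X); rewrite /= ?subrr ?subr0 ?mul1r ?mul0r ?addr0 ?add0r.
Qed.

Definition stationary_cost lam d := discounted_cost T rho beta lam (stationary d).

Lemma stationary_cost_cvg lam d X : simplex X ->
  horizon_cost lam (stationary d) n [::] X @[n --> \oo] --> stationary_cost lam d X.
Proof. exact/discounted_cost_cvg/stationary_policy. Qed.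

Lemma stationary_costE lam d X : simplex X -> stationary_cost lam d X =
  stage_cost lam X (d X) + beta * next X (d X) (stationary_cost lam d).
Proof.
move=> Xs; have lim1 : horizon_cost lam (stationary d) n.+1 [::] X @[n --> \oo] -->
    stationary_cost lam d X.
  rewrite (cvg_shiftS (fun n => horizon_cost lam (stationary d) n [::] X)).
  exact: stationary_cost_cvg.
suff lim2 : horizon_cost lam (stationary d) n.+1 [::] X @[n --> \oo] -->
    stage_cost lam X (d X) + beta * next X (d X) (stationary_cost lam d).
  exact: (cvg_unique _ lim1 lim2).
under eq_fun do rewrite horizon_stationaryS.
apply: cvgD; first exact: cvg_cst.
apply: cvgM; first exact: cvg_cst.
apply: (next_cvg (@simplex R N)) => //; first exact: simplex_closed.
exact: stationary_cost_cvg.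
Qed.

Lemma stationary_cost_norm lam d X : simplex X ->
  `|stationary_cost lam d X| <= (C + `|lam|) / (1 - beta).
Proof.
move=> Xs; apply: (cvgr_to_le (cvg_norm (stationary_cost_cvg lam d X Xs))).
by apply: nearW => n; apply: horizon_cost_norm => //; exact: stationary_policy.
Qed.

(** Each use of the evaluation equations gains a factor [beta] on the distance between the two
    solutions, which is bounded at the start. Only the actions at beliefs in [P] matter. *)
Lemma evaluation_unique (P : set belief) lam d d' g g' c : reach_closed T P ->
  (forall X, P X -> `|g X - g' X| <= c) ->
  (forall X, P X -> g X = stage_cost lam X (d X) + beta * next X (d X) g) ->
  (forall X, P X -> g' X = stage_cost lam X (d' X) + beta * next X (d' X) g') ->
  (forall X, P X -> d X = d' X) ->
  forall X, P X -> g X = g' X.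
Proof.
move=> Pcl gc gE gE' dd'.
have contr n X : P X -> `|g X - g' X| <= geometric c beta n.
  elim: n X => [|n IH] X PX; first by rewrite /= expr0 mulr1; exact: gc.
  rewrite gE// gE'// dd'// opprD addrACA subrr add0r -mulrBr normrM ger0_norm//.
  rewrite /= exprS mulrCA ler_wpM2l//; exact: (next_dist rho01 P).
move=> X PX; apply/eqP; rewrite -subr_eq0 -normr_le0.
have gcvg : geometric c beta n @[n --> \oo] --> 0.
  by apply: cvg_geometric; rewrite ger0_norm//; case/andP: beta01.
apply: (cvgr_to_ge gcvg); apply: nearW => n; exact: contr.
Qed.

Lemma stationary_cost_eq (P : set belief) lam d d' : reach_closed T P ->
  (forall X, P X -> d X = d' X) ->
  forall X, P X -> stationary_cost lam d X = stationary_cost lam d' X.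
Proof.
move=> Pcl dd'; have [Ps _ _] := Pcl.
set K := (C + `|lam|) / (1 - beta).
apply: (evaluation_unique _ lam _ _ _ _ (K + K) Pcl _ _ _ dd') => X PX.
- rewrite (le_trans (ler_normB _ _))// lerD// stationary_cost_norm//; exact: Ps.
- by rewrite -stationary_costE//; exact: Ps.
- by rewrite -stationary_costE//; exact: Ps.
Qed.

(** This is the expected discounted number of activations under [d]. *)
Definition stationary_slope d X := stationary_cost 1 d X - stationary_cost 0 d X.

(** The affine interpolation between the charges 0 and 1 solves the evaluation equation at charge
    [lam], so uniqueness applies. *)
Lemma stationary_cost_affine lam d X : simplex X ->
  stationary_cost lam d X = stationary_slope d X * lam + stationary_cost 0 d X.
Proof.
move=> Xs; rewrite mulrC.
(* The nesting [a * _ + _] is the shape required by [next_linear]. *)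
pose g Y := lam * (-1 * stationary_cost 0 d Y + stationary_cost 1 d Y) +
  stationary_cost 0 d Y.
have -> : lam * stationary_slope d X + stationary_cost 0 d X = g X.
  by rewrite /g /stationary_slope; ring.
have sc := simplex_closed T_stoch.
pose K (l : R) : R := (C + `|l|) / (1 - beta).
move: X Xs; apply: (evaluation_unique (@simplex R N) lam d d _ _
  (K lam + (`|lam| * (K 0 + K 1) + K 0))) => //.
- move=> X Xs; apply: le_trans (ler_normB _ _) _.
  apply: lerD; first exact: stationary_cost_norm.
  apply: le_trans (ler_normD _ _) _.
  apply: lerD; last exact: stationary_cost_norm.
  rewrite normrM ler_wpM2l//; apply: le_trans (ler_normD _ _) _.
  by rewrite mulN1r normrN; apply: lerD; exact: stationary_cost_norm.
- by move=> X Xs; exact: stationary_costE.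
- move=> X Xs; rewrite {1}/g /g !next_linear.
  rewrite [in LHS](stationary_costE 0)// [in LHS](stationary_costE 1)// /stage_cost.
  by ring.
Qed.

(** At each step the stage costs for the charges 1 and 0 differ by 0 or 1, and [K] is the fixed
    point of the map sending [a] to [1 + beta * a]; the finite-horizon bounds pass to the limit. *)
Lemma stationary_slope_bound d X : simplex X ->
  0 <= stationary_slope d X <= 1 / (1 - beta).
Proof.
move=> Xs; set K := 1 / (1 - beta).
have K0 : 0 <= K by rewrite divr_ge0// ltW.
have KE : K = 1 + beta * K by rewrite /K; field; rewrite gt_eqF.
have sc := simplex_closed T_stoch.
have bound n Y : simplex Y ->
    horizon_cost 0 (stationary d) n [::] Y <= horizon_cost 1 (stationary d) n [::] Y
      <= 1 * horizon_cost 0 (stationary d) n [::] Y + K.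
  elim: n Y => [|n IH] Y Ys; first by rewrite /horizon_cost !big_geq// mulr0 add0r lexx.
  rewrite !horizon_stationaryS /stage_cost.
  have lo := next_le rho01 (@simplex R N) Y (d Y) _ _ sc Ys
    (fun Z Zs => (andP (IH Z Zs)).1).
  have hi := next_le rho01 (@simplex R N) Y (d Y) _ _ sc Ys
    (fun Z Zs => (andP (IH Z Zs)).2).
  rewrite next_linear next_cst// in hi.
  have := ler_wpM2l beta0 lo; have := ler_wpM2l beta0 hi.
  have d0 : 0 <= (d Y)%:R :> R by exact: ler0n.
  have d1 : (d Y)%:R <= 1 :> R by case: (d Y); rewrite ?ler01.
  by rewrite mulrDr; lra.
have slope_cvg : horizon_cost 1 (stationary d) n [::] X -
    horizon_cost 0 (stationary d) n [::] X @[n --> \oo] --> stationary_slope d X.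
  by apply: cvgB; exact: stationary_cost_cvg.
apply/andP; split; [apply: (cvgr_to_ge slope_cvg)|apply: (cvgr_to_le slope_cvg)];
  apply: nearW => n; have /andP[? ?] := bound n X Xs; rewrite /=; lra.
Qed.

(** * Value iteration and the optimal stationary policy *)

Definition bellman lam g X := entropy X +
  Num.min (lam + beta * next X true g) (beta * next X false g).

Definition value_iteration lam n := iter n (bellman lam) (fun=> 0).

Lemma bellman_le lam g g' X : simplex X ->
  (forall Y, simplex Y -> g Y <= g' Y) -> bellman lam g X <= bellman lam g' X.
Proof.
move=> Xs gg'; rewrite lerD2l le_min !ge_min; apply/andP; split; apply/orP.
- left; rewrite lerD2l ler_wpM2l//.
  exact: (next_le rho01 _ _ _ _ _ (simplex_closed T_stoch) Xs).
- right; rewrite ler_wpM2l//.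
  exact: (next_le rho01 _ _ _ _ _ (simplex_closed T_stoch) Xs).
Qed.

(** The upper bound does not involve the charge, because staying passive is always possible and free
    of charge. *)
Lemma value_iteration_bound lam n X : 0 <= lam -> simplex X ->
  0 <= value_iteration lam n X <= C / (1 - beta).
Proof.
move=> lam0; have sc := simplex_closed T_stoch.
have CE : C / (1 - beta) = C + beta * (C / (1 - beta)).
  by field; rewrite gt_eqF.
elim: n X => [|n IH] X Xs; first by rewrite lexx divr_ge0// ltW.
have next_bound u : 0 <= next X u (value_iteration lam n) <= C / (1 - beta).
  rewrite -{1}(@next0 _ _ T rho X u) -(@next_cst _ _ T rho X u (C / (1 - beta)) Xs).
  by apply/andP; split; apply: (next_le rho01 _ _ _ _ _ sc Xs) => Y /IH/andP[].
have /andP[H0 HC] := entropy_bound _ _ _ Xs.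
have /andP[n10 n11] := next_bound true; have /andP[n00 n01] := next_bound false.
rewrite /value_iteration iterS -/(value_iteration lam n) /bellman.
apply/andP; split.
  by rewrite addr_ge0// le_min ?addr_ge0// mulr_ge0.
by rewrite CE lerD// ge_min [X in _ || X]ler_wpM2l ?orbT.
Qed.

Lemma value_iteration_nondecreasing lam X : 0 <= lam -> simplex X ->
  nondecreasing_seq (fun n => value_iteration lam n X).
Proof.
move=> lam0 Xs; apply/nondecreasing_seqP => n.
elim: n X Xs => [|n IH] X Xs; last exact: bellman_le.
by have /andP[] := value_iteration_bound lam 1 X lam0 Xs.
Qed.

Definition opt_cost lam X := limn (fun n => value_iteration lam n X).

Lemma value_iteration_cvg lam X : 0 <= lam -> simplex X ->
  value_iteration lam n X @[n --> \oo] --> opt_cost lam X.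
Proof.
move=> lam0 Xs; apply: nondecreasing_is_cvgn.
  exact: value_iteration_nondecreasing.
exists (C / (1 - beta)) => _ [n _ <-].
by have /andP[] := value_iteration_bound lam n X lam0 Xs.
Qed.

Lemma opt_cost_bound lam X : 0 <= lam -> simplex X ->
  0 <= opt_cost lam X <= C / (1 - beta).
Proof.
move=> lam0 Xs; have Vc := value_iteration_cvg lam X lam0 Xs.
apply/andP; split; [apply: (cvgr_to_ge Vc)|apply: (cvgr_to_le Vc)];
  by apply: nearW => n; have /andP[] := value_iteration_bound lam n X lam0 Xs.
Qed.

Lemma opt_cost_bellman lam X : 0 <= lam -> simplex X ->
  opt_cost lam X = bellman lam (opt_cost lam) X.
Proof.
move=> lam0 Xs; have Vc := value_iteration_cvg lam X lam0 Xs.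
rewrite -(cvg_shiftS (fun n => value_iteration lam n X)) in Vc.
suff Bc : value_iteration lam n.+1 X @[n --> \oo] --> bellman lam (opt_cost lam) X.
  exact: (cvg_unique _ Vc Bc).
have next_lim u : beta * next X u (value_iteration lam n) @[n --> \oo] -->
    beta * next X u (opt_cost lam).
  apply: cvgM; first exact: cvg_cst.
  apply: (next_cvg (@simplex R N)) => //; first exact: simplex_closed.
  by move=> Y; exact: value_iteration_cvg.
apply: cvgD; first exact: cvg_cst.
by apply: cvg_min => //; apply: cvgD => //; exact: cvg_cst.
Qed.

(** A randomized action averages two costs, each at least the minimum in the Bellman operator. *)
Lemma value_iteration_le_horizon lam pi n h X : is_policy pi -> simplex X ->
  value_iteration lam n X <= horizon_cost lam pi n h X.
Proof.
move=> pi01; have sc := simplex_closed T_stoch.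
elim: n h X => [|n IH] h X Xs; first by rewrite /horizon_cost big_geq.
rewrite /value_iteration iterS -/(value_iteration lam n) horizon_costS big_bool.
have le_step u : bellman lam (value_iteration lam n) X <= stage_cost lam X u +
    beta * next X u (horizon_cost lam pi n (rcons h (X, u))).
  have : beta * next X u (value_iteration lam n) <=
      beta * next X u (horizon_cost lam pi n (rcons h (X, u))).
    by rewrite ler_wpM2l//; apply: (next_le rho01 _ _ _ _ _ sc Xs) => Y; exact: IH.
  rewrite /bellman /stage_cost -addrA lerD2l ge_min.
  by case: u => le_next; rewrite ?mulr1 ?mulr0 ?add0r ?lerD2l le_next ?orbT.
have /andP[p0 p1] := pi01 h X; have q0 : 0 <= 1 - pi h X by rewrite subr_ge0.
have := ler_wpM2l p0 (le_step true); have := ler_wpM2l q0 (le_step false).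
rewrite /action_prob /=; lra.
Qed.

Lemma opt_cost_le lam pi X : 0 <= lam -> is_policy pi -> simplex X ->
  opt_cost lam X <= discounted_cost T rho beta lam pi X.
Proof.
move=> lam0 pi01 Xs.
apply: (ler_cvg_to (value_iteration_cvg lam X lam0 Xs)
                   (discounted_cost_cvg lam pi X pi01 Xs)).
by apply: nearW => n; exact: value_iteration_le_horizon.
Qed.

Definition advantage lam X := lam +
  beta * (next X true (opt_cost lam) - next X false (opt_cost lam)).

(** Ties are broken in favour of passivity. *)
Definition opt_action lam X : bool := advantage lam X < 0.

(** For the greedy action the Bellman equation becomes an evaluation equation, whose bounded
    solution is unique. *)
Lemma opt_cost_stationary lam X : 0 <= lam -> simplex X ->
  opt_cost lam X = stationary_cost lam (opt_action lam) X.
Proof.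
move=> lam0 Xs; set K := (C + `|lam|) / (1 - beta).
move: X Xs; apply: (evaluation_unique (@simplex R N) lam (opt_action lam)
  (opt_action lam) _ _ (C / (1 - beta) + K)) => //.
- exact: simplex_closed.
- move=> X Xs; apply: le_trans (ler_normB _ _) _.
  apply: lerD; last exact: stationary_cost_norm.
  by have /andP[V0 VC] := opt_cost_bound lam X lam0 Xs; rewrite ger0_norm.
- move=> X Xs; rewrite {1}opt_cost_bellman// /bellman /stage_cost /opt_action.
  have -> : (advantage lam X < 0) =
      (lam + beta * next X true (opt_cost lam) < beta * next X false (opt_cost lam)).
    by rewrite /advantage mulrBr addrA subr_lt0.
  rewrite /Order.min; case: ltP => _.
    by rewrite /= mulr1 addrA.
  by rewrite /= mulr0 addr0.
- by move=> X Xs; exact: stationary_costE.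
Qed.

Lemma value_opt_cost lam X : 0 <= lam -> simplex X ->
  value T rho beta X lam = opt_cost lam X.
Proof.
move=> lam0 Xs; rewrite /value; set E := [set _ | _ in _].
have Elb : lbound E (opt_cost lam X).
  by move=> _ [pi pi01 <-]; exact: opt_cost_le.
have Eopt : E (opt_cost lam X).
  exists (stationary (opt_action lam)); first exact: stationary_policy.
  by rewrite opt_cost_stationary.
apply/eqP; rewrite eq_le; apply/andP; split.
  by apply: ge_inf => //; exists (opt_cost lam X).
by apply: lb_le_inf => //; exists (opt_cost lam X).
Qed.

Lemma opt_cost_le_line d lam X : simplex X -> 0 <= lam ->
  opt_cost lam X <= stationary_slope d X * lam + stationary_cost 0 d X.
Proof.
move=> Xs lam0; rewrite -stationary_cost_affine//.
by apply: opt_cost_le => //; exact: stationary_policy.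
Qed.

Lemma opt_cost_eq_line lam X : simplex X -> 0 <= lam -> exists d,
  opt_cost lam X = stationary_slope d X * lam + stationary_cost 0 d X.
Proof.
move=> Xs lam0; exists (opt_action lam).
by rewrite -stationary_cost_affine//; exact: opt_cost_stationary.
Qed.

Lemma opt_cost_nondecreasing lam lam' X : simplex X -> 0 <= lam -> lam <= lam' ->
  opt_cost lam X <= opt_cost lam' X.
Proof.
move=> Xs lam0 le_lam; have lam'0 := le_trans lam0 le_lam.
apply: (envelope_nondecreasing (fun l => opt_cost l X)
  (stationary_slope ^~ X) (stationary_cost 0 ^~ X) (1 / (1 - beta))).
- by move=> d x; exact: opt_cost_le_line.
- by move=> x; exact: opt_cost_eq_line.
- by move=> d; exact: stationary_slope_bound.
- by rewrite in_itv/= lam0.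
- by rewrite in_itv/= lam'0.
- exact: le_lam.
Qed.

Lemma opt_cost_lipschitz lam lam' X : simplex X -> 0 <= lam -> 0 <= lam' ->
  `|opt_cost lam X - opt_cost lam' X| <= 1 / (1 - beta) * `|lam - lam'|.
Proof.
move=> Xs lam0 lam'0.
apply: (envelope_lipschitz (fun l => opt_cost l X)
  (stationary_slope ^~ X) (stationary_cost 0 ^~ X)) => //.
- by move=> d x; exact: opt_cost_le_line.
- by move=> x; exact: opt_cost_eq_line.
- by move=> d; exact: stationary_slope_bound.
Qed.

(** The charge itself contributes 1 and each of the two continuation values [1 / (1 - beta)]. The
    constant is uniform in [X], so one neighbourhood of a charge serves infinitely many beliefs. *)
Lemma advantage_lipschitz lam lam' X : simplex X -> 0 <= lam -> 0 <= lam' ->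
  `|advantage lam X - advantage lam' X| <=
    (1 + 2 / (1 - beta)) * `|lam - lam'|.
Proof.
move=> Xs lam0 lam'0; have sc := simplex_closed T_stoch.
have dist u : `|next X u (opt_cost lam) - next X u (opt_cost lam')| <=
    1 / (1 - beta) * `|lam - lam'|.
  by apply: (next_dist rho01 _ _ _ _ _ _ sc Xs) => Y Ys; exact: opt_cost_lipschitz.
have -> : advantage lam X - advantage lam' X = (lam - lam') +
    beta * ((next X true (opt_cost lam) - next X true (opt_cost lam')) -
            (next X false (opt_cost lam) - next X false (opt_cost lam'))).
  by rewrite /advantage; ring.
apply: le_trans (ler_normD _ _) _; rewrite mulrDl mul1r lerD2l normrM ger0_norm//.
have b1 : beta <= 1 by case/andP: beta01 => _ /ltW.
apply: le_trans (ler_wpM2r (normr_ge0 _) b1) _; rewrite mul1r.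
apply: le_trans (ler_normB _ _) _.
by have := dist true; have := dist false; lra.
Qed.

(** * Behaviour near the stationary distribution *)

Section AtStationary.
Variable mu : belief.
Hypothesis mu_stat : T *m mu = mu.
Hypothesis mu_simplex : simplex mu.
Hypothesis mu_gt0 : forall i, 0 < mu i 0.
Hypothesis mu_lim : forall X, simplex X ->
  forall i, iter n (mulmx T) X i 0 @[n --> \oo] --> mu i 0.

Lemma opt_cost_stat_le lam : 0 <= lam ->
  opt_cost lam mu <= entropy mu + beta * opt_cost lam mu.
Proof.
move=> lam0; rewrite {1}opt_cost_bellman// lerD2l /= mu_stat ge_min.
by rewrite lexx orbT.
Qed.

Lemma opt_cost_stat_passive lam : 0 <= lam -> 0 <= advantage lam mu ->
  opt_cost lam mu = entropy mu + beta * opt_cost lam mu.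
Proof.
move=> lam0 adv0; rewrite {1}opt_cost_stationary// stationary_costE//.
rewrite /opt_action ltNge adv0 /stage_cost mulr0 addr0 /= mu_stat.
by rewrite -opt_cost_stationary.
Qed.

(* Once passivity is optimal at the stationary belief, its cost no longer
   depends on the charge, while all other costs are nondecreasing. *)
Lemma advantage_stat_increasing lam lam' : 0 <= lam -> lam < lam' ->
  0 <= advantage lam mu -> 0 < advantage lam' mu.
Proof.
move=> lam0 lt_lam adv0; have lam'0 : 0 <= lam' by rewrite (le_trans lam0)// ltW.
have V_eq : opt_cost lam' mu <= opt_cost lam mu.
  have Vp := opt_cost_stat_passive lam lam0 adv0.
  have Vle := opt_cost_stat_le lam' lam'0.
  by rewrite -(ler_pM2l beta1); lra.
(* Removing the failed transmissions, which stay at [mu], leaves a combination of values at the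
   columns of [T], nondecreasing in the charge. *)
have next1 : next mu true (opt_cost lam) - (1 - rho) * opt_cost lam mu <=
    next mu true (opt_cost lam') - (1 - rho) * opt_cost lam' mu.
  rewrite /= mu_stat !addrK; apply: ler_sum => k _.
  have /andP[rho0 _] := rho01; rewrite ler_wpM2l ?mulr_ge0 ?(ltW rho0) ?(ltW (mu_gt0 k))//.
  by apply: opt_cost_nondecreasing => //; exact: ltW.
have rV : rho * opt_cost lam' mu <= rho * opt_cost lam mu.
  by have /andP[rho0 _] := rho01; rewrite ler_pM2l.
apply: le_lt_trans adv0 _; rewrite /advantage.
rewrite ltr_leD// ler_wpM2l//=.
rewrite mu_stat; move: next1; rewrite /= mu_stat; lra.
Qed.

(** After a first zero the advantage is positive, so there is no second one. *)
Lemma advantage_stat_zero : exists c, forall lam, 0 <= lam -> lam != c ->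
  advantage lam mu != 0.
Proof.
have [[c [c0 adv_c]]|no_zero] :=
    pselect (exists c, 0 <= c /\ advantage c mu = 0); last first.
  by exists 0 => lam lam0 _; apply/eqP => adv0; apply: no_zero; exists lam.
exists c => lam lam0 lam_c; apply/eqP => adv_lam.
case: (ltgtP lam c) lam_c => // lt_lam _.
  have := advantage_stat_increasing _ _ lam0 lt_lam.
  by rewrite adv_lam adv_c ltxx => /(_ (lexx _)).
have := advantage_stat_increasing _ _ c0 lt_lam.
by rewrite adv_lam adv_c ltxx => /(_ (lexx _)).
Qed.

(** The entries of [mu] are positive, so [ln] is continuous at each of them. *)
Lemma entropy_iter_cvg X : simplex X ->
  entropy (iter n (mulmx T) X) @[n --> \oo] --> entropy mu.
Proof.
move=> Xs; apply: cvgN; apply: cvg_big => [|i _]; first exact: add_continuous.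
apply: cvgM; first exact: mu_lim.
apply: cvgM; last exact: cvg_cst.
apply: (@cvg_comp _ _ _ (fun n => iter n (mulmx T) X i 0) (@ln R) _ (nbhs (mu i 0))).
  exact: mu_lim.
exact: continuous_ln.
Qed.

(** The distance to the value at [mu] is, at time [n], at most [eta n] plus [beta] times the
    distance at time [n.+1], with [eta] tending to 0. Unrolling [k] times leaves an arbitrarily
    small error plus a bounded quantity times [beta ^+ k]. *)
Lemma opt_cost_iter_cvg lam X : 0 <= lam -> simplex X ->
  opt_cost lam (iter n (mulmx T) X) @[n --> \oo] --> opt_cost lam mu.
Proof.
move=> lam0 Xs; set V := opt_cost lam; pose Y n := iter n (mulmx T) X.
have Ys n : simplex (Y n) by exact: simplex_iter.
pose jump (Z : belief) := \sum_k rho * Z k 0 * V (col k T).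
have jump_cvg : jump (Y n) @[n --> \oo] --> jump mu.
  apply: cvg_big => [|k _]; first exact: add_continuous.
  apply: cvgM; last exact: cvg_cst.
  by apply: cvgM; [exact: cvg_cst|exact: mu_lim].
pose eta n := `|entropy (Y n) - entropy mu| + `|jump (Y n) - jump mu|.
have eta_cvg : eta n @[n --> \oo] --> 0.
  have H0 : entropy (Y n) - entropy mu @[n --> \oo] --> 0.
    rewrite -[0](subrr (entropy mu)); apply: cvgB; last exact: cvg_cst.
    exact: entropy_iter_cvg.
  have J0 : jump (Y n) - jump mu @[n --> \oo] --> 0.
    by rewrite -[0](subrr (jump mu)); apply: cvgB => //; exact: cvg_cst.
  have : eta n @[n --> \oo] --> `|0 : R| + `|0 : R| by apply: cvgD; exact: cvg_norm.
  by rewrite normr0 addr0.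
have rec n : `|V (Y n) - V mu| <= eta n + beta * `|V (Y n.+1) - V mu|.
  pose m Z := Num.min (lam + beta * next Z true V) (beta * next Z false V).
  have -> : V (Y n) - V mu = (entropy (Y n) - entropy mu) + (m (Y n) - m mu).
    rewrite [V (Y n)](opt_cost_bellman lam (Y n) lam0 (Ys n)).
    by rewrite [V mu](opt_cost_bellman lam mu lam0 mu_simplex) opprD addrACA.
  apply: le_trans (ler_normD _ _) _.
  rewrite /eta -addrA lerD2l; apply: dist_min_le.
    rewrite /= -/(jump _) -/(jump _) mu_stat -/(Y n.+1).
    have -> : lam + beta * (jump (Y n) + (1 - rho) * V (Y n.+1)) -
        (lam + beta * (jump mu + (1 - rho) * V mu)) =
        beta * (jump (Y n) - jump mu) + beta * (1 - rho) * (V (Y n.+1) - V mu) by ring.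
    have /andP[/ltW rho0 rho1] := rho01; have b1 : beta <= 1 by case/andP: beta01 => _ /ltW.
    have q0 : 0 <= 1 - rho by rewrite subr_ge0.
    apply: le_trans (ler_normD _ _) _; apply: lerD.
      by rewrite normrM ger0_norm// ler_piMl.
    by rewrite normrM ger0_norm ?mulr_ge0// ler_wpM2r// ler_piMr// gerBl.
  rewrite /= mu_stat -/(Y n.+1) -mulrBr normrM (ger0_norm beta0).
  by rewrite lerDr.
pose B := C / (1 - beta) + C / (1 - beta).
(* The error [e] stays universally quantified, as the induction on [k] halves it. *)
have bound k : forall e, 0 < e -> \forall n \near \oo,
    `|V (Y n) - V mu| <= e + geometric B beta k.
  elim: k => [|k IH] e e0.
    near=> n; rewrite /= expr0 mulr1 ler_wpDl ?(ltW e0)//.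
    apply: le_trans (ler_normB _ _) _.
    have /andP[? ?] := opt_cost_bound lam (Y n) lam0 (Ys n).
    have /andP[? ?] := opt_cost_bound lam mu lam0 mu_simplex.
    by rewrite lerD// ger0_norm.
  have e2 : 0 < e / 2 by rewrite divr_gt0.
  have [n0 _ n0P] := IH _ e2.
  have near_eta : \forall n \near \oo, `|eta n| <= e / 2 by exact: cvgr0_norm_le.
  near=> n; apply: le_trans (rec n) _.
  have le_eta : eta n <= e / 2.
    by apply: le_trans (ler_norm _) _; near: n.
  have le_next : `|V (Y n.+1) - V mu| <= e / 2 + geometric B beta k.
    apply: n0P => /=; apply: leqW; near: n; exact: nbhs_infty_ge.
  have b1 : beta <= 1 by case/andP: beta01 => _ /ltW.
  have := ler_wpM2l beta0 le_next; have := ler_wpM2r (ltW e2) b1.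
  rewrite /= exprS; lra.
apply/cvgrPdistC_le => e e0; have e2 : 0 < e / 2 by rewrite divr_gt0.
have gcvg : geometric B beta k @[k --> \oo] --> 0.
  by apply: cvg_geometric; rewrite ger0_norm//; case/andP: beta01.
have [k _ kP] := cvgr0_norm_le _ gcvg _ e2.
have := bound k _ e2; apply: filterS => n /le_trans; apply.
rewrite [leRHS](splitr e) lerD2l; apply: le_trans (ler_norm _) _.
exact: (kP k (leqnn k)).
Unshelve. all: by end_near. Qed.

Lemma advantage_iter_cvg lam X : 0 <= lam -> simplex X ->
  advantage lam (iter n (mulmx T) X) @[n --> \oo] --> advantage lam mu.
Proof.
move=> lam0 Xs.
have V_cvg : opt_cost lam (T *m iter n (mulmx T) X) @[n --> \oo] -->
    opt_cost lam (T *m mu).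
  rewrite mu_stat (cvg_shiftS (fun n => opt_cost lam (iter n (mulmx T) X))).
  exact: opt_cost_iter_cvg.
apply: cvgD; first exact: cvg_cst.
apply: cvgM; first exact: cvg_cst.
apply: cvgB => //=; apply: cvgD.
  apply: cvg_big => [|k _]; first exact: add_continuous.
  apply: cvgM; last exact: cvg_cst.
  by apply: cvgM; [exact: cvg_cst|exact: mu_lim].
by apply: cvgM => //; exact: cvg_cst.
Qed.

Definition restart X (o : option 'I_N) := if o is Some k then col k T else X.

(** A belief is determined by the last state observed, or [None] before any observation, and the
    number of steps elapsed since; this makes the set a finite union of orbits. *)
Definition reachable X : set belief :=
  [set Y | exists o n, Y = iter n (mulmx T) (restart X o)].

Lemma restart_simplex X o : simplex X -> simplex (restart X o).
Proof. by case: o => [k|] //= _; exact: T_stoch. Qed.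

Lemma reachable_closed X : simplex X -> reach_closed T (reachable X).
Proof.
move=> Xs; split.
- by move=> _ [ o [n ->]]; apply: simplex_iter => //; exact: restart_simplex.
- by move=> _ [ o [n ->]]; exists o, n.+1.
- by move=> k; exists (Some k), 0%N.
Qed.

(* Near a charge at which the stationary belief has a strict preference [b],
   all but finitely many reachable beliefs share that preference, so only the
   finitely many policies deviating from [b] on the remaining beliefs [F] can
   be optimal. *)
Lemma opt_cost_local_min lam0 X : simplex X -> 0 <= lam0 ->
  advantage lam0 mu != 0 ->
  exists (eps : R) (s : seq (R * R)), 0 < eps /\
    forall lam, 0 <= lam -> `|lam - lam0| < eps ->
      min_of_lines (fun l => opt_cost l X) s lam.
Proof.
move=> Xs lam0_ge0 adv0; set b := opt_action lam0 mu.
set delta := `|advantage lam0 mu|; have delta0 : 0 < delta by rewrite normr_gt0.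
have delta2 : 0 < delta / 2 by rewrite divr_gt0.
(* A common [n0] exists because there are finitely many restarting points. *)
have [n0 _ n0P] : \forall n \near \oo, forall o : option 'I_N,
    `|advantage lam0 mu - advantage lam0 (iter n (mulmx T) (restart X o))| <= delta / 2.
  apply: filter_forall => o; apply: cvgr_dist_le => //.
  by apply: advantage_iter_cvg => //; exact: restart_simplex.
set L := 1 + 2 / (1 - beta).
have L0 : 0 < L by rewrite addr_gt0// divr_gt0.
exists (delta / 2 / L).
pose F := [seq iter n (mulmx T) (restart X o) | o <- enum {: option 'I_N}, n <- iota 0 n0].
(* The bit mask [m] selects the beliefs of [F] at which [d m] is active. *)
pose d (m : (size F).-tuple bool) Y := if Y \in F then Y \in mask m F else b.
exists [seq (stationary_slope (d m) X, stationary_cost 0 (d m) X) |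
        m <- enum {: (size F).-tuple bool}].
split; first by rewrite divr_gt0.
move=> lam lam_ge0 lam_near; split.
  by move=> _ /mapP[m _ ->]; exact: opt_cost_le_line.
pose m : (size F).-tuple bool := [tuple of map (opt_action lam) (in_tuple F)].
exists (stationary_slope (d m) X, stationary_cost 0 (d m) X).
  by apply: map_f; rewrite mem_enum.
rewrite -stationary_cost_affine// opt_cost_stationary//.
apply: (stationary_cost_eq (reachable X)); first exact: reachable_closed.
  move=> Y [ o [n YE]]; rewrite /d /= -filter_mask mem_filter.
  case: ifPn => [YF|YF]; first by rewrite YF andbT.
  have n0n : (n0 <= n)%N.
    rewrite leqNgt; apply: contra YF => nn0; rewrite YE.
    by apply: allpairs_f; rewrite ?mem_enum// mem_iota.
  have Ys : simplex Y by rewrite YE; apply: simplex_iter => //; exact: restart_simplex.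
  (* Changing the charge moves the advantage by less than [delta / 2], and passing from [mu] to [Y]
     by at most [delta / 2]; the sign at [mu] therefore persists. *)
  have close : `|advantage lam Y - advantage lam0 Y| < delta / 2.
    apply: le_lt_trans (advantage_lipschitz _ _ _ Ys lam_ge0 lam0_ge0) _.
    by rewrite mulrC -ltr_pdivlMr.
  have := n0P n n0n o; rewrite -YE => close0.
  rewrite /b /opt_action; move: close close0; rewrite /delta.
  case: (ltgtP (advantage lam0 mu) 0) adv0 => // adv0 _.
    rewrite (ltr0_norm adv0) ltr_distl ler_distl => /andP[_ ?] /andP[? _].
    by lra.
  rewrite (gtr0_norm adv0) ltr_distl ler_distl => /andP[? _] /andP[_ ?].
  by apply/negbTE; rewrite -leNgt; lra.
by exists None, 0%N.
Qed.

End AtStationary.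

End Evaluation.

Theorem theorem1 (R : realType) (N : nat) (T : 'M[R]_N) (rho beta : R)
    (hN : (2 <= N)%N)
    (hT : column_stochastic T)
    (hirr : irreducible_chain T)
    (haper : aperiodic_chain T)
    (hrho : 0 < rho <= 1)
    (hbeta : 0 <= beta < 1)
    (X : 'cV[R]_N) (hX : simplex X) :
  [/\ {in `[0, +oo[ &, {homo value T rho beta X : l m / l <= m}},
      concave_function `[0, +oo[ (value T rho beta X),
      piecewise_linear (value T rho beta X),
      (forall lambda : R, 0 < lambda -> derivable (value T rho beta X) lambda 1 ->
         0 <= derive1 (value T rho beta X) lambda <= 1 / (1 - beta)) &
      (forall lambda : R, 0 <= lambda ->
         exists2 d, is_right_derivative (value T rho beta X) lambda d
                    & 0 <= d <= 1 / (1 - beta)) /\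
      (forall lambda : R, 0 < lambda ->
         exists2 d, is_left_derivative (value T rho beta X) lambda d
                    & 0 <= d <= 1 / (1 - beta))].
Proof.
pose p d := @stationary_slope R N T rho beta d X.
pose q d := @stationary_cost R N T rho beta 0 d X.
have valueE l : 0 <= l -> value T rho beta X l = @opt_cost R N T rho beta l X.
  by move=> l0; exact: value_opt_cost.
have f_le d l : 0 <= l -> value T rho beta X l <= p d * l + q d.
  by move=> l0; rewrite valueE//; exact: opt_cost_le_line.
have f_eq l : 0 <= l -> exists d, value T rho beta X l = p d * l + q d.
  by move=> l0; rewrite valueE//; exact: opt_cost_eq_line.
have p_bound d : 0 <= p d <= 1 / (1 - beta) by exact: stationary_slope_bound.
split.
- exact: envelope_nondecreasing f_le f_eq p_bound.
- exact: envelope_concave f_le f_eq.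
- have [mu [mu_stat mu_s mu_gt0 mu_lim]] :=
    stationary_distribution (ltnW hN) hT hirr haper.
  (* The only charge near which break points may accumulate is the possible zero [c] of the
     advantage at [mu]. *)
  have [c advc] := advantage_stat_zero hT hrho hbeta mu mu_stat mu_s mu_gt0.
  apply: (piecewise_linear_locally_min _ c).
    exact: envelope_continuous f_le f_eq p_bound.
  move=> l l0 /(advc l l0) adv_l.
  have [eps [s [eps0 sP]]] :=
    opt_cost_local_min hT hrho hbeta mu mu_stat mu_s mu_gt0 mu_lim l X hX l0 adv_l.
  exists eps, s; split => // y y0 /(sP y y0)[sle [z zs zE]].
  by split; [move=> w ws|exists z => //]; rewrite valueE//; exact: sle.
- by move=> l; exact: envelope_derive1 f_le f_eq p_bound l.
- split=> l.
  + exact: envelope_right_derivative f_le f_eq p_bound l.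
  + exact: envelope_left_derivative f_le f_eq p_bound l.
Qed.
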